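(* Let $r\ge 1$ and $i,j\ge 0$ be integers, let $G=\widehat G(r,i,j)$, let $n=i+j+r+2$ be its number of vertices, and let $k=|D(G)|/2$. Then $$\lambda_2(G)\ \ge\ \frac{n-k+1-\sqrt{(n-k+1)^2-4(n-2k)}}{2}.$$
   Context: Graphs are finite, simple and undirected. The Laplacian of a graph on $n$ vertices is $L=\Delta-A$, where $\Delta$ is the diagonal matrix of degrees and $A$ is the adjacency matrix; its eigenvalues are listed as $0=\lambda_1(G)\le\lambda_2(G)\le\cdots\le\lambda_n(G)$ with multiplicity. $d(x,v)$ denotes graph distance and $D(G)=\{v\in V(G): \text{there is some } x\in V(G)\text{ with } d(x,v)\ge 3\}$. The graph $G(r,i,j)$, on $n=i+j+r+2$ vertices, is obtained as follows: begin with an edge between vertices $a$ and $b$; add $r$ new vertices each adjacent to exactly $a$ and $b$; add $i$ new vertices each adjacent only to $a$; and add $j$ new vertices each adjacent only to $b$. For $r\ge 1$, $\widehat G(r,i,j)$ is the graph obtained from $G(r,i,j)$ by deleting the edge between $a$ and $b$. *)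

(* Defs.v *)
From HB Require Import structures.
From mathcomp Require Import all_boot all_order all_algebra.
From mathcomp Require Import polyrcf complex.

Set Implicit Arguments.
Unset Strict Implicit.
Unset Printing Implicit Defensive.

Import Order.TTheory GRing.Theory Num.Theory.
Local Open Scope ring_scope.

Record sgraph := SGraph {
  vertex :> finType;
  adj : rel vertex;
  adj_sym : symmetric adj;
  adj_irrefl : irreflexive adj
}.

Definition degree (G : sgraph) (v : G) : nat := #|[set w | adj v w]|.

(* Rows and columns follow the enumeration [enum_val] of the vertices. *)
Definition adjmx (R : nzRingType) (G : sgraph) : 'M[R]_#|G| :=
  \matrix_(u, v) (adj (enum_val u) (enum_val v))%:R.

Definition degmx (R : nzRingType) (G : sgraph) : 'M[R]_#|G| :=
  diag_mx (\row_v (degree (enum_val v))%:R).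

Definition laplacian (R : nzRingType) (G : sgraph) : 'M[R]_#|G| :=
  degmx R G - adjmx R G.

(* The nondecreasing list of all the roots of p in R, each repeated according
   to its multiplicity: [rootsR] is increasing and has no repetition. *)
Definition roots_mult (R : rcfType) (p : {poly R}) : seq R :=
  flatten [seq nseq (mup x p) x | x <- rootsR p].

Definition laplacian_eigenvalues (R : rcfType) (G : sgraph) : seq R :=
  roots_mult (char_poly (laplacian R G)).

(* Numbered from 1: [lambda R G 1] is the least eigenvalue. *)
Definition lambda (R : rcfType) (G : sgraph) (m : nat) : R :=
  nth 0 (laplacian_eigenvalues R G) m.-1.

Definition has_walk (G : sgraph) (x y : G) (m : nat) : bool :=
  [exists p : m.-tuple G, path (@adj G) x p && (last x p == y)].

(* The least length of a walk from x to y; [None] stands for infinity. A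
   shortest walk has fewer than #|G| edges, which bounds the search. *)
Definition dist (G : sgraph) (x y : G) : option nat :=
  let m := find (has_walk x y) (iota 0 #|G|) in
  if (m < #|G|)%N then Some m else None.

Definition Dset (G : sgraph) : {set G} :=
  [set v | [exists x : G, if dist x v is Some m then (3 <= m)%N else true]].

Definition del_edge_rel (G : sgraph) (x y : G) : rel G :=
  fun u v => adj u v && ~~ (((u == x) && (v == y)) || ((u == y) && (v == x))).

Lemma del_edge_sym (G : sgraph) (x y : G) : symmetric (del_edge_rel x y).
Proof.
move=> u v; rewrite /del_edge_rel adj_sym orbC.
by rewrite [(u == y) && _]andbC [(u == x) && _]andbC.
Qed.

Lemma del_edge_irrefl (G : sgraph) (x y : G) : irreflexive (del_edge_rel x y).
Proof. by move=> u; rewrite /del_edge_rel adj_irrefl. Qed.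

Definition del_edge (G : sgraph) (x y : G) : sgraph :=
  SGraph (del_edge_sym x y) (del_edge_irrefl x y).

Section Family.
Variables r i j : nat.

Definition Gvertex : finType := (bool + ('I_r + ('I_i + 'I_j)))%type.

Definition va : Gvertex := inl false.
Definition vb : Gvertex := inl true.

Definition Gedge (u v : Gvertex) : bool :=
  match u, v with
  | inl false, inl true => true                (* a -- b *)
  | inl _, inr (inl _) => true                 (* a, b -- common neighbours *)
  | inl false, inr (inr (inl _)) => true       (* a -- its i pendants *)
  | inl true, inr (inr (inr _)) => true        (* b -- its j pendants *)
  | _, _ => false
  end.

Definition Gadj : rel Gvertex := fun u v => Gedge u v || Gedge v u.

Lemma Gadj_sym : symmetric Gadj.
Proof. by move=> u v; rewrite /Gadj orbC. Qed.

Lemma Gadj_irrefl : irreflexive Gadj.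
Proof. by case=> [[]|[|[]]]. Qed.

Definition Ggraph : sgraph := SGraph Gadj_sym Gadj_irrefl.

Definition Ghat : sgraph := @del_edge Ggraph va vb.

Lemma card_Ghat : #|Ghat| = (i + j + r + 2)%N.
Proof.
rewrite [LHS](_ : _ = #|{: bool + ('I_r + ('I_i + 'I_j))}|) //.
by rewrite !card_sum card_bool !card_ord addnC [(r + _)%N]addnC.
Qed.

End Family.

Lemma roots_mult_sorted (R : rcfType) (p : {poly R}) :
  sorted <=%R (roots_mult p).
Proof.
rewrite /roots_mult; have := sorted_roots (- cauchy_bound p) (cauchy_bound p) p.
rewrite -/(rootsR p) sorted_pairwise; last exact: lt_trans.
rewrite sorted_pairwise; last exact: le_trans.
elim: (rootsR p) => //= x s IHs /andP[/allP xs /IHs ss].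
rewrite pairwise_cat ss andbT; apply/andP; split.
  apply/allrelP => y z; rewrite mem_nseq => /andP[_ /eqP->].
  case/flattenP => _ /mapP[t ts ->]; rewrite mem_nseq => /andP[_ /eqP->].
  exact/ltW/xs.
elim: (mup x p) => //= m ->; rewrite andbT.
by apply/allP => y; rewrite mem_nseq => /andP[_ /eqP->].
Qed.

Lemma perm_roots_mult (R : rcfType) (s : seq R) :
  perm_eq (roots_mult (\prod_(x <- s) ('X - x%:P))) s.
Proof.
set p := \prod_(x <- s) _.
have p0 : p != 0 by rewrite monic_neq0 ?monic_prod_XsubC.
apply/allP => x _ /=; apply/eqP; rewrite -[RHS]mu_prod_XsubC -/p.
rewrite /roots_mult count_flatten -map_comp.
have -> : [seq (count_mem x \o (fun y => nseq (mup y p) y)) y | y <- rootsR p]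
        = [seq (if y == x then mup x p else 0)%N | y <- rootsR p].
  apply: eq_map => y /=; rewrite count_nseq /=.
  by case: eqP => [->|]; rewrite ?mul1n ?mul0n.
have rE : root p x = (x \in rootsR p) by have := roots_on_rootsR p0 x; rewrite in_itv.
have: uniq (rootsR p) by exact: uniq_roots.
have [/mupNroot mu0 _|] := boolP (~~ root p x).
  rewrite mu0; elim: (rootsR p) => //= y l ->; by case: ifP.
rewrite negbK => px; have: x \in rootsR p by rewrite -rE.
elim: (rootsR p) => //= y l IHl; rewrite inE => /orP[/eqP <-|xl] /andP[yl ul].
  rewrite eqxx; suff -> : sumn [seq (if z == x then mup x p else 0)%N | z <- l] = 0%N.
    by rewrite addn0.
  elim: l yl {IHl ul} => //= z l IHl; rewrite inE negb_or => /andP[xz /IHl ->].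
  by rewrite eq_sym (negPf xz).
by case: eqP => [yx|_]; [rewrite yx xl in yl | rewrite IHl].
Qed.

Lemma laplacian_sym (R : nzRingType) (G : sgraph) : (laplacian R G)^T = laplacian R G.
Proof.
apply/matrixP => u v; rewrite !mxE adj_sym; congr (_ - _).
by rewrite [v == u]eq_sym; case: eqP => // ->.
Qed.

Lemma char_poly_sym_split (R : rcfType) n (A : 'M[R]_n) : A^T = A ->
  exists s : seq R, char_poly A = \prod_(x <- s) ('X - x%:P).
Proof.
move=> AT; pose f := real_complex R; pose B := map_mx f A.
have Breal : B \is a mxOver Num.real.
  by apply/mxOverP => u v; rewrite mxE complex_real.
have Bherm : B \is hermsymmx.
  apply: realsym_hermsym => //; apply/is_hermitianmxP.
  by rewrite expr0 scale1r map_mx_id // /B map_trmx AT.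
have /orthomx_spectralP BE := hermitian_normalmx Bherm.
have /mxOverP dreal := hermitian_spectral_diag_real Bherm.
set d := spectral_diag B in BE dreal.
exists [seq complex.Re (d 0 k) | k <- enum 'I_n].
apply: (map_poly_inj (f : {rmorphism R -> R[i]})).
rewrite map_char_poly -/B rmorph_prod /= big_map big_enum /=.
have -> : char_poly B = char_poly (diag_mx d).
  rewrite /char_poly /char_poly_mx {1}BE.
  pose P := map_mx polyC (spectralmx B).
  pose P' := map_mx polyC (invmx (spectralmx B)).
  have PP : P' *m P = 1%:M by rewrite -map_mxM mulVmx ?spectral_unit // map_mx1.
  rewrite !map_mxM -/P -/P'.
  have -> : \det ('X%:M - P' *m map_mx polyC (diag_mx d) *m P) =
            \det (P' *m 'X%:M *m P - P' *m map_mx polyC (diag_mx d) *m P).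
    by rewrite (scalar_mxC 'X P') -(mulmxA 'X%:M) PP mulmx1.
  by rewrite -mulmxBl -mulmxBr !det_mulmx mulrAC -det_mulmx PP det1 mul1r.
rewrite char_poly_trig ?diag_mx_is_trig //; apply: eq_bigr => k _.
by rewrite rmorphB /= map_polyX map_polyC /= /f RRe_real // mxE eqxx mulr1n.
Qed.

Lemma char_poly_laplacian (R : rcfType) (G : sgraph) :
  char_poly (laplacian R G) =
    \prod_(x <- laplacian_eigenvalues R G) ('X - x%:P).
Proof.
have [s sE] := char_poly_sym_split (laplacian_sym R G).
by rewrite /laplacian_eigenvalues sE (perm_big _ (perm_roots_mult s)).
Qed.

(* Main.v *)
Require Import Defs.
From mathcomp Require Import all_boot all_order all_algebra.
From mathcomp Require Import ring lra.

(** Since the Laplacian [L] kills the all-ones matrix [J],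
    [char_poly L * ('X - n) = 'X * char_poly (L + J)]; hence it suffices to bound
    the eigenvalues [l] having an eigenvector with zero sum. If such an [l < 1]
    existed below the bound, the eigenvector would be determined by its values at
    the hubs [a] and [b], and [A := (1 - l) (r - l) - i l],
    [B := (1 - l) (r - l) - j l] would satisfy the secular equation
    [A B (2 - l) = r (1 - l) (A + B)]. It has no solution [l < 0], and by AM-GM
    none in [0 < l < 1] with [A + B > 0]. As [|D| = i + j + [i > 0] + [j > 0]],
    being below the bound forces [A + B > 0] unless exactly one of [i], [j]
    vanishes; there the claim reduces to the nonnegativity of a quartic in
    [1 - l], which is a perfect square for [r = 1] (where [i = 1] gives the path
    on four vertices and equality). *)

Import Order.TTheory GRing.Theory Num.Theory.
Local Open Scope ring_scope.

(** * Adding the all-ones matrix to a matrix that annihilates it *)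

Lemma prod_XsubC_two (F : idomainType) (c : F) (s : seq F) :
  (forall x, x \in s -> x = 0 \/ x = c) ->
  \prod_(x <- s) ('X - x%:P) =
    'X^(size s - count_mem c s) * ('X - c%:P) ^+ count_mem c s
  /\ \sum_(x <- s) x = c *+ count_mem c s.
Proof.
elim: s => [|x s IHs] sP; first by rewrite !big_nil mulr1.
have [y ys|pE sE] := IHs; first by apply: sP; rewrite inE ys orbT.
rewrite !big_cons pE /=; have cs := count_size (pred1 c) s.
have [->|xc] := eqVneq x c.
  by rewrite add1n subSS exprS mulrCA; rewrite sE mulrS.
have [x0|/eqP] := sP x (mem_head _ _); last by rewrite (negPf xc).
by rewrite x0 subr0 add0n subSn // exprS mulrA sE add0r.
Qed.

(** From [J *m J = n.+1%:R *: J] every eigenvalue is 0 or [n.+1], and the trace [n.+1] makes the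
    latter simple. *)
Lemma char_poly_const1 (R : rcfType) n :
  char_poly (const_mx 1 : 'M[R]_n.+1) = 'X^n * ('X - n.+1%:R%:P).
Proof.
set J := const_mx 1; have JT : J^T = J by rewrite trmx_const.
have [s sE] := char_poly_sym_split JT.
have ss : size s = n.+1.
  by have := size_char_poly J; rewrite sE size_prod_XsubC => -[].
have JJ : J *m J = n.+1%:R *: J.
  apply/matrixP => i j; rewrite !mxE mulr1.
  under eq_bigr do rewrite !mxE mulr1.
  by rewrite sumr_const card_ord.
have [x xs|pE sumE] := prod_XsubC_two R n.+1%:R s.
  have : eigenvalue J x by rewrite eigenvalue_root_char sE root_prod_XsubC.
  case/eigenvalueP => v vJ v0.
  have : (x * (x - n.+1%:R)) *: v = 0.
    have := congr1 (mulmx v) JJ; rewrite mulmxA -scalemxAr vJ -scalemxAl vJ.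
    by rewrite !scalerA mulrBr scalerBl [x * n.+1%:R]mulrC => ->; rewrite subrr.
  move/eqP; rewrite scaler_eq0 (negPf v0) orbF mulf_eq0 subr_eq0.
  by case/orP => /eqP; [left|right].
suff c1 : count_mem n.+1%:R s = 1%N by rewrite sE pE c1 ss subSS subn0.
have := char_poly_trace J isT.
have -> : \tr J = n.+1%:R.
  rewrite /mxtrace; under eq_bigr do rewrite mxE.
  by rewrite sumr_const card_ord.
rewrite sE /= -[n in _`_n]/(n.+1.-1) -ss coefPn_prod_XsubC ?ss // sumE.
move/oppr_inj/eqP; rewrite -mulrnA eqr_nat -[X in _ == X]muln1 eqn_pmul2l //.
by move/eqP.
Qed.

(** If [A J = 0] then [(X - A)(X - J) = X (X - (A + J))]; take determinants and cancel ['X^n]. *)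
Lemma char_polyD_const1 (R : rcfType) n (A : 'M[R]_n.+1) :
  A *m (const_mx 1 : 'M_n.+1) = 0 ->
  char_poly A * ('X - n.+1%:R%:P) = 'X * char_poly (A + const_mx 1).
Proof.
set J := const_mx 1 => AJ.
apply: (mulfI (monic_neq0 (monicXn R n))).
have -> : 'X^n * (char_poly A * ('X - n.+1%:R%:P)) =
          char_poly A * char_poly J by rewrite char_poly_const1 mulrCA.
rewrite mulrA -exprSr -det_scalar -!det_mulmx; congr (\det _).
rewrite mul_scalar_mx mulmxBr !mulmxBl -map_mxM AJ map_mx0 subr0.
rewrite mul_scalar_mx scalar_mxC mul_scalar_mx mul_scalar_mx /char_poly_mx map_mxD.
by rewrite scalerBr scalerDr opprD addrA.
Qed.

(** * Zero-sum eigenvectors of the Laplacian *)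

Section Laplacian.
Variables (R : rcfType) (G : sgraph).
Local Notation n := #|G|.
Local Notation L := (laplacian R G).

Lemma mulmx_laplacian (v : 'rV[R]_n) w :
  (v *m L) 0 w =
    \sum_u (adj (enum_val u) (enum_val w))%:R * (v 0 w - v 0 u).
Proof.
rewrite mulmxBr !mxE.
under [in RHS]eq_bigr do rewrite mulrBr.
rewrite sumrB; congr (_ - _); last first.
  by apply: eq_bigr => u _; rewrite mxE mulrC.
rewrite (bigD1 w) //= big1 => [|u uw]; last first.
  by rewrite !mxE (negPf uw) mulr0n mulr0.
rewrite !mxE eqxx mulr1n addr0 -mulr_suml mulrC; congr (_ * _).
rewrite -natr_sum; congr (_%:R); rewrite /degree cardsE -sum1_card.
rewrite big_mkcond /= (reindex_onto enum_val enum_rank) /=; last first.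
  by move=> u _; rewrite enum_rankK.
apply: eq_big => [u|u _]; first by rewrite enum_valK eqxx.
rewrite adj_sym -[adj _ _]/(enum_val u \in adj (enum_val w)).
by case: (_ \in _).
Qed.

Lemma sum_mulmx_laplacian (v : 'rV[R]_n) : \sum_w (v *m L) 0 w = 0.
Proof.
pose S := \sum_w \sum_u (adj (enum_val u) (enum_val w))%:R * (v 0 w - v 0 u).
(* Exchanging the two summation indices negates each term, by symmetry of [adj]. *)
suff : S = - S.
  move/eqP; rewrite -addr_eq0 -mulr2n mulrn_eq0 /= => /eqP S0.
  by rewrite -[RHS]S0; apply: eq_bigr => w _; rewrite mulmx_laplacian.
rewrite {1}/S exchange_big -sumrN; apply: eq_bigr => w _.
rewrite -sumrN; apply: eq_bigr => u _.
by rewrite adj_sym -mulrN opprB.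
Qed.

Lemma const1_mul_laplacian : (const_mx 1 : 'M_n) *m L = 0.
Proof.
apply/row_matrixP => i; apply/rowP => w.
rewrite row_mul mulmx_laplacian row0 [RHS]mxE big1 // => u _.
by rewrite !mxE subrr mulr0.
Qed.

Lemma laplacian_mul_const1 : L *m (const_mx 1 : 'M_n) = 0.
Proof.
apply: trmx_inj; rewrite trmx_mul laplacian_sym trmx_const trmx0.
exact: const1_mul_laplacian.
Qed.

(** An eigenvector for a nonzero eigenvalue has zero sum, because the entries of [v *m L] sum to 0.
    The delicate case is a double eigenvalue 0, where a zero-sum kernel vector has to be produced.
    Since [1 < n], [lambda R G 2] is a genuine entry of the list, not the default 0. *)
Lemma lambda2_ge (b : R) : (1 < n)%N ->
  (forall (f : G -> R) l,
     (forall w, \sum_u (adj u w)%:R * (f w - f u) = l * f w) ->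
     \sum_u f u = 0 -> (exists w, f w != 0) -> b <= l) ->
  b <= lambda R G 2.
Proof.
move=> n1 fP; pose J : 'M[R]_n := const_mx 1.
have vP (v : 'rV_n) l : v != 0 -> v *m L = l *: v -> \sum_w v 0 w = 0 -> b <= l.
  move=> v0 vL vS; apply: (fP (fun u => v 0 (enum_rank u))).
  - move=> w; have := congr1 (fun u : 'rV_n => u 0 (enum_rank w)) vL.
    rewrite mulmx_laplacian !mxE => <-.
    rewrite (reindex_onto enum_rank enum_val) /= => [|u _];
      last exact: enum_valK.
    by apply: eq_big => [u|u _]; rewrite !enum_rankK ?eqxx.
  - rewrite -[RHS]vS [RHS](reindex_onto enum_rank enum_val) /= => [|u _];
      last exact: enum_valK.
    by apply: eq_bigl => u; rewrite enum_rankK eqxx.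
  - have [w vw|v00] := pickP (fun w => v 0 w != 0).
      by exists (enum_val w); rewrite enum_valK.
    case/eqP: v0; apply/rowP => w; rewrite mxE.
    by apply/eqP; rewrite -[_ == _]negbK v00.
have sE := char_poly_laplacian R G.
have ss : size (laplacian_eigenvalues R G) = n.
  by have := size_char_poly L; rewrite sE size_prod_XsubC => -[].
have nzP l : l \in laplacian_eigenvalues R G -> l != 0 -> b <= l.
  rewrite -root_prod_XsubC -sE -eigenvalue_root_char => /eigenvalueP[v vL v0] l0.
  apply: (vP _ _ v0 vL); apply: (mulfI l0); rewrite mulr0 mulr_sumr.
  rewrite -[RHS](sum_mulmx_laplacian v).
  by apply: eq_bigr => w _; rewrite vL mxE.
have := roots_mult_sorted (char_poly L); rewrite -/(laplacian_eigenvalues R G).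
rewrite /lambda /=; move: n1 sE nzP; rewrite -{1}ss; move: ss.
case: (laplacian_eigenvalues R G) => [|x [|y s]] //= ss _ sE nzP /andP[xy _].
have [y0|] := eqVneq y 0; last by apply: nzP; rewrite !inE eqxx orbT.
have [x0|xn0] := eqVneq x 0; last first.
  by apply: le_trans xy; apply: nzP; rewrite ?mem_head.
(* A double root 0 makes [L + J] singular; its kernel is orthogonal to 1. *)
have : eigenvalue (L + J) 0.
  rewrite eigenvalue_root_char.
  have LJ := laplacian_mul_const1.
  move: sE LJ; rewrite -/J x0 y0; move: L; rewrite /J -ss /= => A sE.
  move/char_polyD_const1.
  rewrite sE !big_cons subr0 -mulrA => /(mulfI (negbT (polyX_eq0 _))) <-.
  by rewrite -mulrA rootM rootX eqxx.
case/eigenvalueP => v; rewrite scale0r mulmxDr => vLJ v0.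
have vJ w : (v *m J) 0 w = \sum_u v 0 u.
  by rewrite mxE; apply: eq_bigr => u _; rewrite mxE mulr1.
have vS : \sum_w v 0 w = 0.
  have : \sum_w ((v *m L + v *m J) 0 w) = 0.
    by rewrite vLJ big1 // => w _; rewrite mxE.
  under eq_bigr do rewrite mxE vJ.
  rewrite big_split /= sum_mulmx_laplacian add0r sumr_const card_ord.
  by move/eqP; rewrite mulrn_eq0 => /orP[|/eqP //]; rewrite -{1}ss.
have vJ0 : v *m J = 0 by apply/rowP => w; rewrite vJ vS mxE.
rewrite y0; apply: (vP v) => //; rewrite scale0r.
by rewrite -vLJ vJ0 addr0.
Qed.
End Laplacian.

(** * Vertices at distance at least 3 in [Ghat] *)

Lemma in_Dset (G : sgraph) (v : G) : (2 < #|G|)%N ->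
  (v \in Dset G) =
    [exists x : G, ~~ [|| x == v, adj x v | [exists w, adj x w && adj w v]]].
Proof.
move=> G2; rewrite inE; apply: eq_existsb => x.
have walk0 : has_walk x v 0 = (x == v).
  apply/existsP/idP => [[p]|xv]; first by rewrite tuple0.
  by exists [tuple].
have walk1 : has_walk x v 1 = adj x v.
  apply/existsP/idP => [[p]|xv].
    by case/tupleP: p => y p; rewrite tuple0 /= andbT => /andP[xy /eqP <-].
  by exists [tuple v]; rewrite /= xv eqxx.
have walk2 : has_walk x v 2 = [exists w, adj x w && adj w v].
  apply/existsP/existsP => [[p]|[w /andP[xw wv]]].
    case/tupleP: p => y p; case/tupleP: p => z p; rewrite tuple0 /= andbT.
    by case/andP=> xyz /eqP <-; exists y.
  by exists [tuple w; v]; rewrite /= xw wv eqxx.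
(* With more than two vertices the search range contains 0, 1 and 2, so failing these three tests
   means distance at least 3 or [None]. *)
rewrite /dist -walk0 -walk1 -walk2; case: #|G| G2 => [|[|[|m]]] //= _.
do 3![case: has_walk => //=]; case: ifP => //.
Qed.

Lemma sum_Gvertex (V : nmodType) r i j (F : Gvertex r i j -> V) :
  \sum_u F u = F (va r i j) + F (vb r i j) + (\sum_(c < r) F (inr (inl c)) +
    (\sum_(p < i) F (inr (inr (inl p))) + \sum_(q < j) F (inr (inr (inr q))))).
Proof.
rewrite big_sumType big_bool [X in X + _ = _]addrC; congr (_ + _).
by rewrite big_sumType; congr (_ + _); rewrite big_sumType.
Qed.

(** A symmetric table that computes on constructors; the deleted edge falls into the default
    branch. *)
Definition Ghat_edge r i j (u v : Gvertex r i j) : bool :=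
  match u, v with
  | inl _, inr (inl _) | inr (inl _), inl _
  | inl false, inr (inr (inl _)) | inr (inr (inl _)), inl false
  | inl true, inr (inr (inr _)) | inr (inr (inr _)), inl true => true
  | _, _ => false
  end.

Lemma Ghat_adjE r i j (u v : Ghat r i j) : adj u v = Ghat_edge r i j u v.
Proof. by case: u => [[]|[?|[?|?]]]; case: v => [[]|[?|[?|?]]]. Qed.

(** A pendant vertex is far from the opposite hub, so each hub belongs to the set exactly when the
    other one has pendants. Common neighbours reach everything within two steps. *)
Lemma in_Dset_Ghat r i j (v : Ghat r i j) : (0 < r)%N ->
  (v \in Dset (Ghat r i j)) = match v with
    | inl false => (0 < j)%N
    | inl true => (0 < i)%N
    | inr (inl _) => false
    | _ => true
    end.
Proof.
move=> r0; pose c0 : Ghat r i j := inr (inl (Ordinal r0)).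
pose a : Ghat r i j := va r i j; pose b : Ghat r i j := vb r i j.
have G2 : (2 < #|Ghat r i j|)%N by rewrite card_Ghat addn2 !ltnS addn_gt0 r0 orbT.
have far (x y : Ghat r i j) : x != y -> ~~ adj x y ->
    (forall w, ~~ (adj x w && adj w y)) -> y \in Dset (Ghat r i j).
  move=> xy nxy nw; rewrite in_Dset //; apply/existsP; exists x.
  by rewrite (negPf xy) (negPf nxy) /=; apply/existsPn.
have near (y : Ghat r i j) :
    (forall x, [\/ x = y, adj x y | exists w, adj x w && adj w y]) ->
    y \in Dset (Ghat r i j) = false.
  move=> xP; rewrite in_Dset //; apply/negbTE/existsPn => x; rewrite negbK.
  case: (xP x) => [->|->|xw]; rewrite ?eqxx ?orbT //.
  by apply/or3P; apply: Or33; apply/existsP.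
case: v => [[]|[c|[p|q]]].
- case: posnP => [i0|i0].
    apply: near => -[[]|[c|[p|q]]]; [exact: Or31 | | exact: Or32 | | exact: Or32].
      by apply: Or33; exists c0; rewrite !Ghat_adjE.
    by case: p => m; rewrite i0.
  apply: (far (inr (inr (inl (Ordinal i0))))); rewrite ?Ghat_adjE //.
  by case=> [[]|[?|[?|?]]]; rewrite !Ghat_adjE.
- case: posnP => [j0|j0].
    apply: near => -[[]|[c|[p|q]]]; [ | exact: Or31 | exact: Or32 | exact: Or32 | ].
      by apply: Or33; exists c0; rewrite !Ghat_adjE.
    by case: q => m; rewrite j0.
  apply: (far (inr (inr (inr (Ordinal j0))))); rewrite ?Ghat_adjE //.
  by case=> [[]|[?|[?|?]]]; rewrite !Ghat_adjE.
- apply: near => -[[]|[c'|[p|q]]]; [exact: Or32 | exact: Or32 | | |].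
  + by apply: Or33; exists a; rewrite !Ghat_adjE.
  + by apply: Or33; exists a; rewrite !Ghat_adjE.
  + by apply: Or33; exists b; rewrite !Ghat_adjE.
- apply: (far b); rewrite ?Ghat_adjE //.
  by case=> [[]|[?|[?|?]]]; rewrite !Ghat_adjE.
- apply: (far a); rewrite ?Ghat_adjE //.
  by case=> [[]|[?|[?|?]]]; rewrite !Ghat_adjE.
Qed.

Lemma card_Dset_Ghat r i j : (0 < r)%N ->
  #|Dset (Ghat r i j)| = (i + j + (0 < i) + (0 < j))%N.
Proof.
move=> r0; rewrite -sum1_card big_mkcond /=.
under eq_bigr do rewrite in_Dset_Ghat //.
rewrite [LHS]sum_Gvertex /= !sum_nat_const !card_ord !muln1 muln0.
rewrite addrC add0r.
by case: (0 < i)%N; case: (0 < j)%N; rewrite /GRing.add /= ?addn1 ?addn0 ?addn2.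
Qed.

(** * The secular equation and its solutions below 1 *)

(** The coefficient of the hub value in the eigenvector equation at a hub with [i] pendants, once
    the pendants are eliminated and [1 - l] is cleared. *)
Definition hub_poly {R : comNzRingType} (r i l : R) : R :=
  (1 - l) * (r - l) - i * l.

(** The hypotheses are a 2 by 2 linear system with a nonzero solution [(a, b)]. Its determinant, [w]
    times the difference of the two sides, must vanish; the identities below are Cramer's rule. *)
Lemma secular_eq (F : fieldType) (r A B u w a b : F) : w != 0 ->
  (a != 0) || (b != 0) ->
  A * a * w = r * u * (a + b) -> B * b * w = r * u * (a + b) ->
  A * B * w = r * u * (A + B).
Proof.
move=> w0 ab0 EA EB.
have Ea : w * (A * B * w - r * u * (A + B)) * a = 0.
  have -> : w * (A * B * w - r * u * (A + B)) * a =
    (B * w - r * u) * (A * a * w - r * u * (a + b))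
    + r * u * (B * b * w - r * u * (a + b)) by ring.
  by rewrite EA EB !subrr !mulr0 addr0.
have Eb : w * (A * B * w - r * u * (A + B)) * b = 0.
  have -> : w * (A * B * w - r * u * (A + B)) * b =
    (A * w - r * u) * (B * b * w - r * u * (a + b))
    + r * u * (A * a * w - r * u * (a + b)) by ring.
  by rewrite EA EB !subrr !mulr0 addr0.
case/orP: ab0 => x0; [move/eqP: Ea|move/eqP: Eb];
  by rewrite !mulf_eq0 (negPf w0) (negPf x0) orbF subr_eq0 => /eqP.
Qed.

(** For [l < 0] both hub polynomials exceed [r * (1 - l)], so the difference of the two sides is a
    sum of positive terms. *)
Lemma secular_neg (R : realFieldType) (r i j l : R) :
  1 <= r -> 0 <= i -> 0 <= j -> l < 0 ->
  hub_poly r i l * hub_poly r j l * (2 - l) !=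
    r * (1 - l) * (hub_poly r i l + hub_poly r j l).
Proof.
move=> r1 i0 j0 l0; set ru := r * (1 - l).
have ru0 : 0 < ru by apply: mulr_gt0; lra.
have hub_gt x : 0 <= x -> ru < hub_poly r x l.
  by move=> x0; rewrite /ru /hub_poly; nra.
move: (hub_gt _ i0) (hub_gt _ j0).
set A := hub_poly _ _ _; set B := hub_poly _ _ _.
move=> Ag Bg; rewrite -subr_eq0 gt_eqF //.
have -> : A * B * (2 - l) - ru * (A + B) =
  A * B * - l + A * (B - ru) + B * (A - ru) by ring.
have A0 : 0 < A by lra.
have B0 : 0 < B by lra.
by apply: addr_gt0; [apply: addr_gt0|]; do ?apply: mulr_gt0 => //; lra.
Qed.

Lemma secular_hub_sum_gt0 (R : realFieldType) (r i j l : R) :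
  1 <= r -> 0 <= i -> 0 <= j -> 0 < l < 1 ->
  0 < hub_poly r i l + hub_poly r j l ->
  hub_poly r i l * hub_poly r j l * (2 - l) !=
    r * (1 - l) * (hub_poly r i l + hub_poly r j l).
Proof.
move=> r1 i0 j0 /andP[l0 l1].
have SE : hub_poly r i l + hub_poly r j l = 2 * (1 - l) * (r - l) - (i + j) * l.
  by rewrite /hub_poly; ring.
move: SE; set A := hub_poly _ _ _; set B := hub_poly _ _ _ => SE S0.
apply/negP => /eqP E.
(* AM-GM: [4 A B <= (A + B) ^+ 2] *)
have E1 : 4 * r * (1 - l) * (A + B) <= (A + B) * (A + B) * (2 - l).
  have : 0 <= (A - B) ^+ 2 * (2 - l) by rewrite mulr_ge0 ?sqr_ge0 //; lra.
  rewrite -subr_ge0 => h; rewrite -subr_ge0; apply: le_trans h _.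
  rewrite le_eqVlt; apply/orP; left; apply/eqP.
  by rewrite -!mulrA [r * _]mulrA -[_ * (A + B)]mulrA [r * _]mulrA -E; ring.
have E2 : 4 * r * (1 - l) <= (A + B) * (2 - l).
  by rewrite -(ler_pM2r S0) [leRHS]mulrAC.
have E3 : (A + B) * (2 - l) <= 2 * (1 - l) * (r - l) * (2 - l).
  by rewrite ler_pM2r; [rewrite SE; nra | lra].
(* This is the amount by which the lower bound in [E2] exceeds the upper bound in [E3]. *)
have : 0 < 2 * ((1 - l) * l * (r + 2 - l)).
  by rewrite !mulr_gt0 //; lra.
lra.
Qed.

(** The positivity hypothesis is twice the quadratic of the bound when one hub has no pendants.
    Writing [r] as [t.+1] makes [t * (t - 1) >= 0] available. *)
Lemma secular_one_sided (R : realFieldType) (t : nat) (i l : R) :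
  let r : R := t.+1%:R in
  1 <= i -> 0 < l < 1 ->
  0 < 2 * l ^+ 2 - (2 * r + i + 5) * l + 2 * (r + 1) ->
  hub_poly r i l * hub_poly r 0 l * (2 - l) !=
    r * (1 - l) * (hub_poly r i l + hub_poly r 0 l).
Proof.
move=> r i1 /andP[l0 l1] p0; apply/negP => /eqP E.
have rE : r = t%:R + 1 by rewrite /r -addn1 natrD.
have r1 : 1 <= r by rewrite rE; have := ler0n R t; lra.
pose g := l ^+ 2 - (r + 2) * l + r.
(* the secular equation divided by [l (1 - l)] *)
have f0 : (l - 1) * (l - r) * (l - r - 2) = i * g.
  apply: (mulfI (lt0r_neq0 (_ : 0 < l * (1 - l)))).
    by rewrite mulr_gt0 //; lra.
  apply/eqP; rewrite -subr_eq0; apply/eqP; rewrite -[RHS](subrr (r * (1 - l) *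
    (hub_poly r i l + hub_poly r 0 l))) -{1}E /hub_poly /g.
  ring.
have F : (l - 1) * (l - r) * (l - r - 2) < 0.
  have : 0 < (1 - l) * (r + 2 - l) by rewrite mulr_gt0 //; lra.
  have : l < r by lra.
  nra.
have g0 : g < 0 by nra.
pose h := 2 * l ^+ 2 - (2 * r + 5) * l + 2 * (r + 1).
(* The quadratic hypothesis says [i * l < h]. Multiplying by [- g > 0] lets [f0] eliminate [i]. *)
have hg : i * l * - g < h * - g by rewrite ltr_pM2r ?oppr_gt0 // /h; lra.
pose u := 1 - l; have u0 : 0 < u by rewrite /u; lra.
have tt : 0 <= t%:R * (t%:R - 1) :> R.
  by case: (t) => [|m]; rewrite ?mul0r // mulr_ge0 // subr_ge0 ler1n.
(* By [hg] and [f0] the left side is positive; in terms of [u] and [t] it is visibly nonpositive. *)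
have Q : h * - g + l * ((l - 1) * (l - r) * (l - r - 2)) =
   - ((u ^+ 2 + 2 * u - 1) ^+ 2 + t%:R * (2 * u ^+ 3 + 6 * u ^+ 2)
      + t%:R * (t%:R - 1) * (u ^+ 2 + u)).
  by rewrite /h /g /u rE; ring.
have : 0 <= (u ^+ 2 + 2 * u - 1) ^+ 2 + t%:R * (2 * u ^+ 3 + 6 * u ^+ 2)
      + t%:R * (t%:R - 1) * (u ^+ 2 + u).
  have u2 : 0 < u ^+ 2 by rewrite exprn_gt0.
  have u3 : 0 < u ^+ 3 by rewrite exprn_gt0.
  apply: addr_ge0; last by rewrite mulr_ge0 //; lra.
  by apply: addr_ge0; rewrite ?sqr_ge0 ?mulr_ge0 //; lra.
move: hg; rewrite f0 in Q; lra.
Qed.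

(* [s / (2 - l)] is the value at the common neighbours and [a / (1 - l)] that at
   the pendant vertices of the hub. *)
Lemma hub_eq (F : fieldType) (r i l a s : F) : 1 - l != 0 -> 2 - l != 0 ->
  r * (a - s / (2 - l)) + i * (a - a / (1 - l)) = l * a ->
  hub_poly r i l * a * (2 - l) = r * (1 - l) * s.
Proof.
move=> u0 w0 h; apply/eqP; rewrite -subr_eq0.
have -> : hub_poly r i l * a * (2 - l) - r * (1 - l) * s = (1 - l) * (2 - l) *
    (r * (a - s / (2 - l)) + i * (a - a / (1 - l)) - l * a).
  by rewrite /hub_poly; field; rewrite u0 w0.
by rewrite h subrr mulr0.
Qed.

(** For [l < 1] the divisors [1 - l] and [2 - l] are nonzero, so the hub values determine [f] and
    cannot both vanish. The zero sum serves to exclude [l = 0]. *)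
Lemma Ghat_secular (R : realFieldType) r i j (f : Ghat r i j -> R) l :
  (0 < r)%N -> l < 1 ->
  (forall w, \sum_u (adj u w)%:R * (f w - f u) = l * f w) ->
  \sum_u f u = 0 -> (exists w, f w != 0) ->
  l != 0 /\ hub_poly r%:R i%:R l * hub_poly r%:R j%:R l * (2 - l) =
    r%:R * (1 - l) * (hub_poly r%:R i%:R l + hub_poly r%:R j%:R l).
Proof.
move=> r0 l1 fE fS f0.
have {}fE w : \sum_u (Ghat_edge r i j u w)%:R * (f w - f u) = l * f w.
  by rewrite -fE; apply: eq_bigr => u _; rewrite Ghat_adjE.
set a := f (va r i j); set b := f (vb r i j).
have u0 : 1 - l != 0 by rewrite gt_eqF //; lra.
have w0 : 2 - l != 0 by rewrite gt_eqF //; lra.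
have fc c : f (inr (inl c)) = (a + b) / (2 - l).
  apply: (mulIf w0); rewrite divfK //; move: (fE (inr (inl c))).
  rewrite [LHS]sum_Gvertex /= -!mulr_sumr !mul0r !mul1r -/a -/b; lra.
have fp p : f (inr (inr (inl p))) = a / (1 - l).
  apply: (mulIf u0); rewrite divfK //; move: (fE (inr (inr (inl p)))).
  rewrite [LHS]sum_Gvertex /= -!mulr_sumr !mul0r !mul1r -/a -/b; lra.
have fq q : f (inr (inr (inr q))) = b / (1 - l).
  apply: (mulIf u0); rewrite divfK //; move: (fE (inr (inr (inr q)))).
  rewrite [LHS]sum_Gvertex /= -!mulr_sumr !mul0r !mul1r -/a -/b; lra.
have ab0 : (a != 0) || (b != 0).
  rewrite -negb_and; apply/negP => /andP[/eqP a0 /eqP b0].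
  case: f0 => -[[]|[c|[p|q]]]; rewrite ?fc ?fp ?fq ?a0 ?b0 ?addr0 ?mul0r ?eqxx //.
    by rewrite -/b b0 eqxx.
  by rewrite -/a a0 eqxx.
have EA : hub_poly r%:R i%:R l * a * (2 - l) = r%:R * (1 - l) * (a + b).
  apply: hub_eq => //; move: (fE (va r i j)).
  rewrite [LHS]sum_Gvertex /= -!mulr_sumr !mul0r !mul1r -/a -/b.
  under eq_bigr do rewrite fc.
  under [X in _ + (_ + (X + _))]eq_bigr do rewrite fp.
  by rewrite !sumr_const !card_ord -!(mulr_natl (_ - _)) => <-; ring.
have EB : hub_poly r%:R j%:R l * b * (2 - l) = r%:R * (1 - l) * (a + b).
  apply: hub_eq => //; move: (fE (vb r i j)).
  rewrite [LHS]sum_Gvertex /= -!mulr_sumr !mul0r !mul1r -/a -/b.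
  under eq_bigr do rewrite fc.
  under [X in _ + (_ + (_ + X))]eq_bigr do rewrite fq.
  by rewrite !sumr_const !card_ord -!(mulr_natl (_ - _)) => <-; ring.
split; last exact: secular_eq w0 ab0 EA EB.
apply/eqP => l0; move: fS; rewrite [LHS]sum_Gvertex -/a -/b.
under eq_bigr do rewrite fc.
under [X in _ + (_ + (X + _))]eq_bigr do rewrite fp.
under [X in _ + (_ + (_ + X))]eq_bigr do rewrite fq.
rewrite !sumr_const !card_ord -(mulr_natl _ r) -(mulr_natl _ i).
rewrite -(mulr_natl _ j) l0 !subr0 !divr1 => S0.
have {}r0 : 0 < r%:R :> R by rewrite ltr0n.
have i0 := ler0n R i; have j0 := ler0n R j.
(* At [l = 0] the hub equations read [2 r a = r (a + b) = 2 r b]; the zero sum then becomes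
   [(2 + r + i + j) b = 0]. *)
have ab : a = b.
  apply: (mulfI (lt0r_neq0 r0)); move: EA EB; rewrite l0 /hub_poly; lra.
move: S0; rewrite ab => S0.
have : (2 + r%:R + i%:R + j%:R) * b = 0 by move: S0; lra.
move/eqP; rewrite mulf_eq0 gt_eqF /=; last by lra.
by move/eqP => b0; move: ab0; rewrite ab b0 eqxx.
Qed.

(** * The lower bound *)

Theorem theorem3p10 (R : rcfType) (r i j : nat) (hr : (1 <= r)%N) :
  let G := Ghat r i j in
  let n : R := (i + j + r + 2)%:R in
  let k : R := #|Dset G|%:R / 2 in
  lambda R G 2 >=
    (n - k + 1 - Num.sqrt ((n - k + 1) ^+ 2 - 4 * (n - 2 * k))) / 2.
Proof.
cbv zeta; set G := Ghat r i j; set n : R := (i + j + r + 2)%:R.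
set k : R := #|Dset G|%:R / 2; apply: lambda2_ge; first by rewrite card_Ghat addn2.
move=> f l fE fS f0; rewrite leNgt; apply/negP => lb.
set D := (n - k + 1) ^+ 2 - 4 * (n - 2 * k) in lb.
have r1 : 1 <= r%:R :> R by rewrite ler1n.
have i0 := ler0n R i; have j0 := ler0n R j.
have k0 : 0 <= k by rewrite divr_ge0 ?ler0n.
(* [D = (n - k - 1) ^+ 2 + 4 * k], which is nonnegative and also shows that the bound is at most
   1. *)
have sq : (Num.sqrt D) ^+ 2 = D.
  apply: sqr_sqrtr; have := sqr_ge0 (n - k - 1); rewrite /D; nra.
have s0 := sqrtr_ge0 D.
have l1 : l < 1.
  have : n - k - 1 <= Num.sqrt D.
    have [|h] := lerP (n - k - 1) 0; first by move/le_trans; apply.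
    rewrite -[_ <= _](@ler_pXn2r _ 2 isT) ?nnegrE ?(ltW h) //.
    by rewrite sq /D; nra.
  lra.
(* [l] lies to the left of the smaller root of this quadratic. *)
have p0 : 0 < l ^+ 2 - (n - k + 1) * l + (n - 2 * k).
  have : D < (n - k + 1 - 2 * l) ^+ 2.
    by rewrite -sq ltr_pXn2r ?nnegrE //; lra.
  rewrite /D; nra.
have [/eqP l0] := Ghat_secular _ _ _ _ _ _ hr l1 fE fS f0.
apply/eqP; have [ln|lp] := ltrP l 0; first exact: secular_neg.
have {}lp : 0 < l < 1 by rewrite l1 lt_def lp !andbT; apply/eqP.
have nE : n = i%:R + j%:R + r%:R + 2 by rewrite /n !natrD.
have kE : k = (i%:R + j%:R + (0 < i)%N%:R + (0 < j)%N%:R) / 2.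
  by rewrite /k card_Dset_Ghat // !natrD.
move: p0; rewrite nE kE.
have [iz|ip] := posnP i; have [jz|jp] := posnP j; rewrite /=.
- move=> _; apply: secular_hub_sum_gt0 => //.
  rewrite iz jz /hub_poly !mul0r subr0 addr_gt0 // mulr_gt0 //; lra.
- rewrite iz add0r addr0 => p0.
  rewrite [hub_poly _ _ _ * _]mulrC [hub_poly _ _ _ + _]addrC.
  case: r hr {f fE fS f0 nE kE r1 G n k D lb sq s0 k0} p0 => // t _ p0.
  apply: secular_one_sided => //; first by rewrite ler1n.
  move: p0; lra.
- rewrite jz => p0.
  case: r hr {f fE fS f0 nE kE r1 G n k D lb sq s0 k0} p0 => // t _ p0.
  apply: secular_one_sided => //; first by rewrite ler1n.
  move: p0; lra.
(* Here [k = (i + j + 2) / 2], and the sum of the hub polynomials is twice the quadratic plus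
   [2 * l]. *)
- move=> p0; apply: secular_hub_sum_gt0 => //.
  rewrite /hub_poly; lra.
Qed.
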